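(* Let $a,b$ be positive integers, let $R=\dfrac{a+\sqrt{a^2+4b}}{2}$, and let $(f[n])_{n\ge 1}$ be defined by $f[1]=f[2]=1$ and $f[n]=a f[n-1]+b f[n-2]$ for $n\ge 3$. For each positive integer $N$ let $\underline{X}=\underline{X}_N$ be a random variable with values in $\{1,\dots,N\}$ and $P(\underline{X}_N=n)=\dfrac{f[N+1-n]}{\sum_{k=1}^{N}f[k]}$ for $1\le n\le N$. Then $$\lim_{N\to\infty}\mathrm{Var}(\underline{X}_N)=\frac{R}{(R-1)^2}.$$
   Context: $\mathrm{Var}$ denotes variance. $R$ is the positive real root of the characteristic equation $r^2-ar-b=0$ of the recurrence. *)

(* Defs.v *)
From HB Require Import structures.
From mathcomp Require Export all_boot all_order all_algebra.
From mathcomp Require Export all_classical all_reals all_analysis.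

(* Main.v *)
(* Divide the power sums [\sum_n n^j f(N+1-n)], [j = 0, 1, 2], by [R^N].  Since
   [f(n) / R^n] tends to a positive constant, each normalized sum satisfies
   [x(N+1) = x(N) / R + v(N)] with [v] convergent, the limit of [v] being known
   from the smaller values of [j].  As [1 / R < 1], such an [x] converges to
   [lim v / (1 - 1/R)]; the three limits give that of the variance. *)
Require Import Defs.
From mathcomp Require Import all_boot all_order all_algebra.
From mathcomp Require Import all_classical all_reals all_analysis.
From mathcomp Require Import ring lra.
Set Implicit Arguments.
Unset Strict Implicit.
Unset Printing Implicit Defensive.
Import Order.TTheory GRing.Theory Num.Theory.
Import numFieldNormedType.Exports.
Local Open Scope classical_set_scope.
Local Open Scope ring_scope.

Section FiniteRange.
Context {K : realType} {d : measure_display} {T : measurableType d}.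
Variables (P : probability T K) (X : {RV P >-> K}) (s : seq K).
Hypotheses (us : uniq s) (Xs : forall w, X w \in s).

(** Since [X] stays in [s], [g \o X] is a finite combination of indicators of the fibres of [X],
    integrated term by term. *)
Lemma expectation_comp_finite_range (g : K -> K) :
  ('E_P[g \o X] = (\sum_(x <- s) g x * fine (P (X @^-1` [set x])))%:E)%E.
Proof.
have mX x : measurable (X @^-1` [set x]).
  by rewrite -[_ @^-1` _]setTI; exact: measurable_funP.
rewrite unlock.
transitivity (\int[P]_w \sum_(x <- s)
    ((g x)%:E * (\1_(X @^-1` [set x]) w)%:E))%E.
  apply: eq_integral => w _ /=.
  rewrite (bigD1_seq (X w)) //= big1_seq ?adde0 => [|x /andP[xXw _]].
    by rewrite indicE mem_set // mule1.
  by rewrite indicE memNset ?mule0 //=; apply/nesym/eqP.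
rewrite integral_sum//; last first.
  by move=> x; apply: integrableZl => //; exact: integrable_indic.
rewrite -sumEFin; apply: eq_bigr => x _.
rewrite integralZl//; last exact: integrable_indic.
by rewrite integral_indic// setIT EFinM fineK// fin_num_measure.
Qed.

Lemma variance_finite_range (p : K -> K) :
    (forall x, x \in s -> P (X @^-1` [set x]) = (p x)%:E) ->
  ('V_P[X] =
    (\sum_(x <- s) x ^+ 2 * p x - (\sum_(x <- s) x * p x) ^+ 2)%:E)%E.
Proof.
move=> Pp.
have E g : ('E_P[g \o X] = (\sum_(x <- s) g x * p x)%:E)%E.
  rewrite expectation_comp_finite_range; congr (_%:E).
  by apply: eq_big_seq => x xs; rewrite Pp.
(* Total mass 1 is the expectation formula applied to the constant 1. *)
have p1 : \sum_(x <- s) p x = 1.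
  have := E (cst 1); rewrite [_ \o _](_ : _ = cst 1)// expectation_cst => -[->].
  by apply: eq_bigr => x _; rewrite mul1r.
have EX : ('E_P[X] = (\sum_(x <- s) x * p x)%:E)%E by rewrite -(E id).
rewrite /variance unlock EX /=; set m := \sum_(x <- s) _ * _.
rewrite [X in expectation _ X](_ : _ = (fun x => (x - m) ^+ 2) \o X); last first.
  by apply/funext => w /=; rewrite expr2.
rewrite E; congr (_%:E).
transitivity (\sum_(x <- s) (x ^+ 2 * p x - (m *+ 2) * (x * p x) + m ^+ 2 * p x)).
  by apply: eq_bigr => x _; ring.
rewrite big_split sumrB -!mulr_sumr p1 -/m /=; ring.
Qed.

End FiniteRange.

Section StableRecurrence.
Variable K : realType.
Implicit Types x v u f : K^nat.

(** The distance from [x n] to the fixed point [L = q * L + l] shrinks by |q| at each step, up to an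
    error |l - v n|. *)
Lemma cvg_stable_recurrence (q l : K) x v : `|q| < 1 ->
    (forall n, x n.+1 = q * x n + v n) -> v @ \oo --> l ->
  x @ \oo --> l / (1 - q).
Proof.
move=> q1 xS vl; set L := l / (1 - q).
have q0 : 0 < 1 - `|q| by rewrite subr_gt0.
have Lq : l = L - q * L.
  rewrite -{1}[L]mul1r -mulrBl mulrC divfK // subr_eq0 eq_sym lt_eqF //.
  exact: le_lt_trans (ler_norm _) q1.
apply/cvgrPdist_le => e e0.
(* This tolerance makes [e / 2] a fixed point of t -> |q| t + (e / 2)(1 - |q|), so the bound [bnd]
   survives the induction. *)
have /cvgrPdist_le/(_ (e / 2 * (1 - `|q|)))[|N _ vN] := vl.
  by rewrite mulr_gt0 // divr_gt0.
have bnd k : `|L - x (k + N)%N| <= `|L - x N| * `|q| ^+ k + e / 2.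
  elim: k => [|k IH]; first by rewrite expr0 mulr1 lerDl divr_ge0 // ltW.
  have -> : L - x (k.+1 + N)%N = q * (L - x (k + N)%N) + (l - v (k + N)%N).
    by rewrite addSn xS Lq; ring.
  apply: le_trans (ler_normD _ _) _; rewrite normrM.
  have vk := vN _ (leq_addl k N).
  have := ler_wpM2l (normr_ge0 q) IH.
  rewrite exprS => IH'.
  apply: le_trans (lerD IH' vk) _.
  by rewrite le_eqVlt; apply/orP; left; apply/eqP; field.
have : (fun k => `|L - x N| * `|q| ^+ k) @ \oo --> (0 : K).
  by apply: cvg_geometric; rewrite normr_id.
move=> /cvgrPdist_le/(_ (e / 2))[|M _ gM]; first by rewrite divr_gt0.
exists (M + N)%N => //= n MNn.
have Nn : (N <= n)%N by apply: leq_trans MNn; exact: leq_addl.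
rewrite -(subnK Nn); apply: le_trans (bnd _) _.
rewrite [leRHS]splitr lerD2r.
have := gM (n - N)%N; rewrite /= sub0r normrN ger0_norm; last first.
  by rewrite mulr_ge0 // exprn_ge0.
by apply; rewrite leq_subRL // addnC.
Qed.

(** The index [n] stands for the value [n.+1], of weight [f (N + 1 - n.+1)]; [j = 0] gives the
    normalizing sum. *)
Definition reversed_moment f j N : K :=
  \sum_(n < N) n.+1%:R ^+ j * f (N - n)%N.

(** From [N] to [N.+1], every weight moves from its value m to m + 1 and the value 1 receives weight
    [f N.+1]. For exponents 1 and 2, expanding the power of m + 1 brings in the lower moments. *)
Lemma reversed_moment0S f N :
  reversed_moment f 0 N.+1 = reversed_moment f 0 N + f N.+1.
Proof.
rewrite /reversed_moment big_ord_recl subn0 expr0 mul1r addrC.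
by congr (_ + _); apply: eq_bigr => i _; rewrite !expr0 subSS.
Qed.

Lemma reversed_moment1S f N :
  reversed_moment f 1 N.+1 =
  reversed_moment f 1 N + reversed_moment f 0 N + f N.+1.
Proof.
rewrite /reversed_moment big_ord_recl subn0 expr1n mul1r addrC.
rewrite -big_split /=; congr (_ + _); apply: eq_bigr => i _.
by rewrite /bump /= add1n subSS -(natr1 i.+1); ring.
Qed.

Lemma reversed_moment2S f N :
  reversed_moment f 2 N.+1 =
  reversed_moment f 2 N + 2 * reversed_moment f 1 N + reversed_moment f 0 N
  + f N.+1.
Proof.
rewrite /reversed_moment big_ord_recl subn0 expr1n mul1r addrC mulr_sumr.
rewrite -!big_split /=; congr (_ + _); apply: eq_bigr => i _.
by rewrite /bump /= add1n subSS -(natr1 i.+1); ring.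
Qed.

(* The variance tends to that of the geometric law with ratio [1 / R]. *)
Lemma cvg_reversed_variance f (R c : K) : 1 < R -> c != 0 ->
    (fun n => f n / R ^+ n) @ \oo --> c ->
  (fun N => reversed_moment f 2 N / reversed_moment f 0 N
            - (reversed_moment f 1 N / reversed_moment f 0 N) ^+ 2) @ \oo -->
  R / (R - 1) ^+ 2.
Proof.
move=> R1 c0 fc.
have R0 : R != 0 by rewrite gt_eqF // (lt_trans _ R1).
have RB : R - 1 != 0 by rewrite subr_eq0 gt_eqF.
pose q := R^-1.
have q0 : 0 < q by rewrite invr_gt0 (lt_trans _ R1).
have q1 : `|q| < 1 by rewrite gtr0_norm // invf_lt1 // (lt_trans _ R1).
have qB : 1 - q != 0.
  by rewrite subr_eq0 gt_eqF //; apply: le_lt_trans q1; exact: ler_norm.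
pose w j N := reversed_moment f j N / R ^+ N.
have uc : (fun n => f n.+1 / R ^+ n.+1) @ \oo --> c by move: fc; rewrite -cvg_shiftS.
have Rn n : R ^+ n != 0 by rewrite expf_neq0.
have w0 : w 0 @ \oo --> c / (1 - q).
  apply: cvg_stable_recurrence q1 _ uc => n.
  by rewrite /w reversed_moment0S /q exprS; field; rewrite R0 Rn.
have w1 : w 1 @ \oo --> (q * (c / (1 - q)) + c) / (1 - q).
  apply: (cvg_stable_recurrence q1 (v := fun n => q * w 0 n + f n.+1 / R ^+ n.+1)).
    by move=> n; rewrite /w reversed_moment1S /q exprS; field; rewrite R0 Rn.
  by apply: cvgD => //; exact: cvgMr.
have w2 : w 2 @ \oo -->
    (q * 2 * ((q * (c / (1 - q)) + c) / (1 - q)) + q * (c / (1 - q)) + c) / (1 - q).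
  apply: (cvg_stable_recurrence q1
      (v := fun n => q * 2 * w 1 n + q * w 0 n + f n.+1 / R ^+ n.+1)).
    by move=> n; rewrite /w reversed_moment2S /q exprS; field; rewrite R0 Rn.
  by apply: cvgD => //; apply: cvgD; exact: cvgMr.
have l0 : c / (1 - q) != 0 by rewrite mulf_neq0 // invr_eq0.
(* The two quotients simplify to (1 + q) / (1 - q)^2 and 1 / (1 - q), so the right-hand side is q /
   (1 - q)^2. *)
have -> : R / (R - 1) ^+ 2 =
    (q * 2 * ((q * (c / (1 - q)) + c) / (1 - q)) + q * (c / (1 - q)) + c) / (1 - q)
      / (c / (1 - q))
    - ((q * (c / (1 - q)) + c) / (1 - q) / (c / (1 - q))) ^+ 2.
  rewrite /q; field.
  by rewrite R0 RB c0.
have r1 : (fun N => w 1 N / w 0 N) @ \oo -->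
    (q * (c / (1 - q)) + c) / (1 - q) / (c / (1 - q)).
  by apply: cvgM w1 _; exact: cvgV.
rewrite expr2 [X in X @ _](_ : _ =
    (fun N => w 2 N / w 0 N - w 1 N / w 0 N * (w 1 N / w 0 N))).
  by apply: cvgB; [apply: cvgM w2 _; exact: cvgV | exact: cvgM].
have wE j N : w j N / w 0 N = reversed_moment f j N / reversed_moment f 0 N.
  by rewrite /w -mulf_div divff ?mulr1 // invr_eq0.
by apply/funext => N; rewrite !wE expr2.
Qed.

(* With [s] the other root of the characteristic polynomial, [f n.+1 - s * f n]
   is geometric of ratio [R], so [f n / R ^+ n] obeys a first-order recurrence
   with multiplier [s / R]. *)
Lemma cvg_linear_recurrence2 f (R s : K) : 0 < R -> `|s| < R ->
    (forall n, f n.+3 = (R + s) * f n.+2 - R * s * f n.+1) ->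
  (fun n => f n / R ^+ n) @ \oo --> (f 2 - s * f 1) / (R * (R - s)).
Proof.
move=> R0 sR frec.
have Rn0 : R != 0 by rewrite gt_eqF.
have Rs : R - s != 0.
  by rewrite subr_eq0 gt_eqF //; apply: le_lt_trans sR; exact: ler_norm.
have geo n : f n.+2 - s * f n.+1 = R ^+ n * (f 2 - s * f 1).
  elim: n => [|n IH]; first by rewrite expr0 mul1r.
  by rewrite exprS -mulrA -IH frec; ring.
(* The recurrence does not constrain [f 0], so the limit is taken along [n.+1]. Dividing [geo] by
   [R ^+ n.+2] then leaves a constant forcing term. *)
rewrite -cvg_shiftS /=.
rewrite (_ : _ / _ = (f 2 - s * f 1) / R ^+ 2 / (1 - s / R)); last first.
  by field; rewrite Rn0 Rs.
apply: (cvg_stable_recurrence (v := cst ((f 2 - s * f 1) / R ^+ 2))).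
- by rewrite normrM normfV (gtr0_norm R0) ltr_pdivrMr // mul1r.
- move=> n /=.
  have -> : f n.+2 = s * f n.+1 + R ^+ n * (f 2 - s * f 1).
    by rewrite -geo; ring.
  rewrite !exprS expr0; field.
  by rewrite Rn0 expf_neq0.
- exact: cvg_cst.
Qed.

End StableRecurrence.

Theorem theorem4p4 (K : realType) (a b : nat) (ha : (0 < a)%N) (hb : (0 < b)%N)
    (R : K) (hR : R = (a%:R + Num.sqrt (a%:R ^+ 2 + 4%:R * b%:R)) / 2%:R)
    (f : nat -> nat) (f1 : f 1%N = 1%N) (f2 : f 2%N = 1%N)
    (frec : forall n : nat, (3 <= n)%N ->
       f n = (a * f (n - 1) + b * f (n - 2))%N)
    (d : nat -> measure_display) (T : forall N : nat, measurableType (d N))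
    (P : forall N : nat, probability (T N) K)
    (X : forall N : nat, {RV (P N) >-> K})
    (Xval : forall N : nat, (0 < N)%N -> forall w : T N,
       exists2 n : nat, (1 <= n <= N)%N & X N w = n%:R)
    (Xlaw : forall N : nat, (0 < N)%N -> forall n : nat, (1 <= n <= N)%N ->
       P N (X N @^-1` [set n%:R]) =
       ((f (N + 1 - n)%N)%:R / \sum_(1 <= k < N.+1) (f k)%:R)%:E) :
  ('V_(P N)[(X N)] @[N --> \oo] --> (R / (R - 1) ^+ 2)%:E)%E.
Proof.
pose F n : K := (f n)%:R.
pose A : K := a%:R; pose B : K := b%:R.
pose D : K := A ^+ 2 + 4%:R * B.
have A1 : 1 <= A by rewrite ler1n.
have B1 : 1 <= B by rewrite ler1n.
have D0 : 0 <= D by rewrite /D; nra.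
(* The roots of the characteristic polynomial sum to [A], so [s] is the other one. *)
pose s := A - R.
have hS : Num.sqrt D = 2 * R - A.
  by rewrite hR -/A -/B -/D; field.
have S0 : 0 <= 2 * R - A by rewrite -hS sqrtr_ge0.
have RR : R ^+ 2 = A * R + B.
  have := sqr_sqrtr D0; rewrite hS /D; lra.
have R1 : 1 < R by nra.
have R0 : 0 < R by lra.
(* From R (R - A) = B > 0 follows A < R, so s < 0 and |s| = R - A < R. *)
have sR : `|s| < R by rewrite ltr_norml /s; apply/andP; split; nra.
have Fc := @cvg_linear_recurrence2 K F R s R0 sR.
have {}Fc : (fun n => F n / R ^+ n) @ \oo --> (F 2 - s * F 1) / (R * (R - s)).
  apply: Fc => n; rewrite /F frec // natrD !natrM subn1 subn2 /= -/A -/B.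
  have -> : B = R ^+ 2 - A * R by rewrite RR; ring.
  by rewrite /s; ring.
(* The numerator is 1 - s because [f 1 = f 2 = 1], and it is positive as s < 0. *)
have c0 : (F 2 - s * F 1) / (R * (R - s)) != 0.
  rewrite mulf_neq0 // ?invr_eq0 ?mulf_neq0 // ?gt_eqF //.
    by rewrite /F f1 f2 /s; nra.
  by move: sR; rewrite ltr_norml /s => /andP[]; lra.
pose v N := reversed_moment F 2 N / reversed_moment F 0 N
            - (reversed_moment F 1 N / reversed_moment F 0 N) ^+ 2.
have vc : (v N)%:E @[N --> \oo] --> (R / (R - 1) ^+ 2)%:E.
  by apply: cvg_EFin; [exact: nearW | exact: cvg_reversed_variance R1 c0 Fc].
(* The law of [X N] is prescribed only for positive [N], so the variance is identified with [v N]
   from 1 on. *)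
apply: cvg_trans vc; apply: near_eq_cvg; exists 1%N => // N /= N0.
have S : \sum_(1 <= k < N.+1) (f k)%:R = reversed_moment F 0 N.
  rewrite big_nat_rev /= big_add1 /= big_mkord; apply: eq_bigr => i _.
  by rewrite expr0 mul1r /F add1n !subSS.
(* Reading the point masses off [P N] defines [p] on all of [K]; [Xlaw] is applied only at the
   listed values, in [M]. *)
pose p x : K := fine (P N (X N @^-1` [set x])).
pose l : seq K := [seq n%:R | n <- index_iota 1 N.+1].
rewrite (@variance_finite_range _ _ _ (P N) (X N) l _ _ p); last first.
- by move=> x _; rewrite /p fineK // fin_num_measure // -[_ @^-1` _]setTI;
    exact: measurable_funP.
- move=> w; have [n nN ->] := Xval _ N0 w.
  by apply: map_f; rewrite mem_index_iota.
- by rewrite map_inj_uniq ?iota_uniq // => m n /eqP; rewrite eqr_nat => /eqP.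
have M j : \sum_(x <- l) x ^+ j * p x =
    reversed_moment F j N / reversed_moment F 0 N.
  rewrite big_map big_add1 /= big_mkord mulr_suml; apply: eq_bigr => i _.
  by rewrite /p Xlaw //= S addn1 subSS mulrA.
by rewrite /v -!M.
Qed.
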